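(* There is a universal constant $C>1$ such that for every integer $k\ge1$, every $\delta\in(0,1]$, and every finite set $V\subset\mathbb{C}^d$ of distinct points which is a $\delta$-$\mathrm{SG}_k$ configuration, we have $\dim(V)\le 2^{C^k}/\delta^2$.
   Context: Let $V\subset\mathbb{C}^d$ be a set of $n$ distinct points. For points $v_1,\ldots,v_k$, $\mathrm{fl}(v_1,\ldots,v_k)$ denotes their affine span; $v_1,\ldots,v_k$ are independent if $\mathrm{fl}(v_1,\ldots,v_k)$ has (affine) dimension $k-1$. A $k$-flat (affine subspace of dimension $k$) is elementary if its intersection with $V$ has exactly $k+1$ points. $V$ is a $\delta$-$\mathrm{SG}_k$ configuration if for every independent $v_1,\ldots,v_k\in V$ there are at least $\delta n$ points $u\in V$ such that either $u\in\mathrm{fl}(v_1,\ldots,v_k)$ or the $k$-flat $\mathrm{fl}(v_1,\ldots,v_k,u)$ is not elementary. $\dim(V)$ is the dimension of the smallest affine subspace containing $V$. *)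

(* Defs.v *)
From HB Require Import structures.
From mathcomp Require Import all_boot all_order all_algebra.
From mathcomp Require Import finmap complex.
From mathcomp Require Import boolp classical_sets reals exp.

Set Implicit Arguments.
Unset Strict Implicit.
Unset Printing Implicit Defensive.

Import Order.TTheory GRing.Theory Num.Theory.

Local Open Scope fset_scope.
Local Open Scope classical_set_scope.
Local Open Scope ring_scope.

(* The empty set is the affine subspace of dimension -1. *)
Definition flat (K : fieldType) (E : vectType K) (m : int) (F : set E) : Prop :=
  (m = -1 /\ F = set0) \/
  exists (p : E) (U : {vspace E}),
    m = Posz (\dim U) /\ F = [set x : E | x - p \in U].

Definition fl (K : fieldType) (E : vectType K) (s : seq E) : set E :=
  [set x : E | exists c : 'I_(size s) -> K,
     \sum_(i < size s) c i = 1 /\ x = \sum_(i < size s) c i *: s`_i].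

Definition independent (K : fieldType) (E : vectType K) (s : seq E) : Prop :=
  flat (Posz (size s) - 1) (fl s).

Definition elementary (K : fieldType) (E : vectType K) (V : {fset E})
    (k : nat) (F : set E) : Prop :=
  flat (Posz k) F /\ #|` [fset x in V | `[< F x >]] | = k.+1.

Definition SG (R : realType) (E : vectType R[i]) (delta : R) (k : nat)
    (V : {fset E}) : Prop :=
  forall v : k.-tuple E, {subset v <= V} -> independent v ->
    delta * #|` V|%:R <=
    #|` [fset u in V | `[< fl v u \/ ~ elementary V k (fl (rcons v u)) >]] |%:R.

(* As a relation: [m] is the dimension of the least affine subspace containing
   [V]. *)
Definition affine_dim (K : fieldType) (E : vectType K) (V : {fset E})
    (m : int) : Prop :=
  exists F : set E,
    [/\ flat m F,
        forall x, x \in V -> F x &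
        forall (m' : int) (G : set E), flat m' G ->
          (forall x, x \in V -> G x) -> F `<=` G].

(* Main.v *)
Require Import Defs.
From HB Require Import structures.
From mathcomp Require Import all_boot all_order all_algebra perm.
From mathcomp Require Import finmap complex.
From mathcomp Require Import boolp classical_sets reals exp.
From mathcomp Require Import fintype finset zify ring lra.

Set Implicit Arguments.
Unset Strict Implicit.
Unset Printing Implicit Defensive.

Import Order.TTheory GRing.Theory Num.Theory.

Local Open Scope ring_scope.

(** Case [k = 1].  If [n] vectors of an [m]-dimensional space can be put by a
    linear map in a position where [sum_i cos^2(v_i, v_j) <= 4 n / m] for all
    [j], then collinear triples force [m = O(1 / delta)], because three coplanar
    vectors always contain a pair with [cos^2] bounded below.  Such a position
    exists when no proper subspace is too dense: it is approached by repeatedly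
    halving the component along an offending vector, which decreases the
    potential [m sum_i ln |v_i T|^2 - n ln |det T|^2] by at least 1, while a
    greedy basis bounds that potential from below.  In general one first divides
    by a subspace minimizing the density of the points outside it.

    Induction on [k].  As long as every point lies on many special lines the
    first case applies.  Otherwise project from a point that lies on few of them,
    keeping the points of its special lines only as possible extra points.  This
    yields a flat of small dimension that misses few points of [V].  Modulo that
    flat, any [k] independent missed points have a further missed point in their
    span: otherwise the extra points determine too few [u].  Hence
    representatives of the missed points form a 1-SG configuration of level
    [k - 1].

    Affine notions are linearized by [x |-> (1, x)]. *)

(** * Complex inner product and angles *)

Section Hermitian.
Variable R : realType.
Implicit Types (z : R[i]).
Local Notation Re := complex.Re.
Local Notation Im := complex.Im.

(** Squared modulus with values in [R], so that it can be compared and passed to [ln]. *)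
Definition nsqc z : R := Re z ^+ 2 + Im z ^+ 2.

Lemma nsqc_ge0 z : 0 <= nsqc z.
Proof. by rewrite addr_ge0 ?sqr_ge0. Qed.

Lemma nsqc_eq0 z : (nsqc z == 0) = (z == 0).
Proof.
by case: z => a b; rewrite paddr_eq0 ?sqr_ge0 //= !sqrf_eq0 eq_complex.
Qed.

Lemma nsqcM : {morph nsqc : z1 z2 / z1 * z2}.
Proof. by move=> [a b] [c d]; rewrite /nsqc /=; ring. Qed.

Lemma nsqcE z : (nsqc z)%:C%C = z * z^*%C.
Proof.
case: z => a b; apply/eqP; rewrite eq_complex /nsqc /=.
by apply/andP; split; apply/eqP; ring.
Qed.

Lemma nsqc_conj z : nsqc z^*%C = nsqc z.
Proof. by case: z => a b; rewrite /nsqc /= sqrrN. Qed.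

Lemma nsqc_real (a : R) : nsqc a%:C%C = a ^+ 2.
Proof. by rewrite /nsqc /= expr0n addr0. Qed.

Variable d : nat.
Implicit Types (u v w x : 'rV[R[i]]_d).

Definition ip u v : R[i] := \sum_k u 0 k * (v 0 k)^*%C.
Definition nsq u : R := \sum_k nsqc (u 0 k).

Lemma ipE u : ip u u = (nsq u)%:C%C.
Proof. by rewrite /ip /nsq rmorph_sum; apply: eq_bigr => k _; rewrite -nsqcE. Qed.

Lemma nsq_ge0 u : 0 <= nsq u.
Proof. by apply: sumr_ge0 => k _; apply: nsqc_ge0. Qed.

Lemma nsq_eq0 u : (nsq u == 0) = (u == 0).
Proof.
apply/idP/eqP => [|->]; last first.
  by rewrite /nsq big1 // => k _; rewrite mxE; apply/eqP; rewrite nsqc_eq0.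
rewrite /nsq psumr_eq0; last by move=> k _; apply: nsqc_ge0.
move/allP=> h; apply/rowP=> k; rewrite mxE; apply/eqP.
by rewrite -nsqc_eq0; apply: (h k); apply: mem_index_enum.
Qed.

Lemma nsq_gt0 u : (0 < nsq u) = (u != 0).
Proof. by rewrite lt_def nsq_ge0 andbT nsq_eq0. Qed.

Lemma ipDl u v w : ip (u + v) w = ip u w + ip v w.
Proof. by rewrite /ip -big_split; apply: eq_bigr => k _; rewrite mxE mulrDl. Qed.

Lemma ipZl c u w : ip (c *: u) w = c * ip u w.
Proof. by rewrite /ip mulr_sumr; apply: eq_bigr => k _; rewrite mxE mulrA. Qed.

Lemma ipC u v : ip u v = (ip v u)^*%C.
Proof.
by rewrite /ip rmorph_sum; apply: eq_bigr => k _; rewrite rmorphM /= conjcK mulrC.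
Qed.

Lemma ipDr u v w : ip w (u + v) = ip w u + ip w v.
Proof. by rewrite ipC ipDl rmorphD /= -!ipC. Qed.

Lemma ipZr c u w : ip w (c *: u) = c^*%C * ip w u.
Proof. by rewrite ipC ipZl rmorphM /= -ipC. Qed.

Lemma ip0l u : ip 0 u = 0.
Proof. by rewrite -(scale0r u) ipZl mul0r. Qed.

Lemma nsqZ c u : nsq (c *: u) = nsqc c * nsq u.
Proof. by rewrite /nsq mulr_sumr; apply: eq_bigr => k _; rewrite mxE nsqcM. Qed.

(** The subtracted vector is half the orthogonal projection of [x] onto [w], so a quarter of the
    squared length of that component survives. *)
Lemma nsq_shrink x w : w != 0 ->
  nsq (x - (ip x w / (2 * (nsq w)%:C%C)) *: w)
    = nsq x - 3 / 4 * (nsqc (ip x w) / nsq w).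
Proof.
move=> w0; have nw : nsq w != 0 by rewrite nsq_eq0.
have nwC : (nsq w)%:C%C != 0 :> R[i] by rewrite eq_complex /= eqxx andbT.
apply: complexI; rewrite -[LHS]ipE -scaleNr ipDl !ipDr !ipZl !ipZr !ipE.
rewrite rmorphB rmorphM /= !fmorph_div /= nsqcE !rmorph_nat (ipC w x).
have -> : (- (ip x w / (2 * (nsq w)%:C%C)))^*%C
    = - ((ip x w)^*%C / (2 * (nsq w)%:C%C)).
  rewrite rmorphN fmorph_div rmorphM; congr (- (_ / (_ * _))).
  - exact: conjc_nat.
  - exact: conjc_real.
by field; rewrite nwC.
Qed.

(** Division by zero makes this 0 when a vector vanishes, so vectors killed by a quotient map add
    nothing to sums of [cos2]. *)
Definition cos2 u v : R := nsqc (ip u v) / (nsq u * nsq v).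

Lemma cos2_ge0 u v : 0 <= cos2 u v.
Proof. by rewrite divr_ge0 ?nsqc_ge0 ?mulr_ge0 ?nsq_ge0. Qed.

Lemma cos2C u v : cos2 u v = cos2 v u.
Proof. by rewrite /cos2 ipC nsqc_conj (mulrC (nsq u)). Qed.

Lemma cos2_id u : u != 0 -> cos2 u u = 1.
Proof. by rewrite -nsq_eq0 => u0; rewrite /cos2 ipE nsqc_real divff // mulf_neq0. Qed.

Lemma cos2Zl c u v : c != 0 -> cos2 (c *: u) v = cos2 u v.
Proof.
rewrite -nsqc_eq0 => c0; rewrite /cos2 ipZl nsqcM nsqZ -[_ * _ * nsq v]mulrA.
by rewrite -mulf_div divff // mul1r.
Qed.

(** Either the angle of [u] and [v] already suffices, or they are nearly orthogonal and adding the
    shorter [u] cannot turn [v] far. *)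
Lemma cos2_plane_aux u v : v + u != 0 -> nsq u <= nsq v ->
  1 / 12 <= cos2 v u + cos2 (v + u) v.
Proof.
move=> w0 le_uv.
have [|hs] := leP (1 / 12) (cos2 v u).
  by move=> h; rewrite (le_trans h) // lerDl cos2_ge0.
suff: 1 / 12 <= cos2 (v + u) v by have := cos2_ge0 v u; lra.
have v0 : 0 < nsq v.
  rewrite lt_def nsq_ge0 andbT; apply: contra w0 => /eqP v0.
  move: le_uv; rewrite v0 => u0; have : nsq u == 0 by rewrite eq_le u0 nsq_ge0.
  by rewrite nsq_eq0 => /eqP->; rewrite addr0 -nsq_eq0 v0.
have hp : nsqc (ip v u) <= 1 / 12 * (nsq v * nsq u).
  have [u0|u0] := eqVneq (nsq u) 0.
    rewrite u0 !mulr0; move/eqP: u0; rewrite nsq_eq0 => /eqP ->.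
    by rewrite ipC ip0l nsqc_conj /nsqc /= expr0n addr0.
  have u0' : 0 < nsq u by rewrite lt_def u0 nsq_ge0.
  by move/ltW: hs; rewrite /cos2 ler_pdivrMr ?mulr_gt0.
have e1 : ip (v + u) v = (nsq v)%:C%C + (ip v u)^*%C by rewrite ipDl ipE -ipC.
have e2 : nsq (v + u) = nsq v + nsq u + 2 * Re (ip v u).
  apply: complexI; rewrite -ipE ipDl !ipDr !ipE (ipC u v).
  case: (ip v u) => a b; apply/eqP; rewrite eq_complex /=.
  by apply/andP; split; apply/eqP; ring.
have w0' : 0 < nsq (v + u) by rewrite nsq_gt0.
rewrite /cos2 ler_pdivlMr ?mulr_gt0 // e1 e2.
move: hp; rewrite e2 in w0'; move: w0'; case: (ip v u) => a b; rewrite /nsqc /=.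
have := nsq_ge0 u.
move: (nsq v) (nsq u) v0 le_uv => x y x0 yx y0 w0' hp.
have hb := sqr_ge0 b.
have ha : a ^+ 2 <= (1 / 3 * x) ^+ 2 by nra.
have x3 : 0 <= 1 / 3 * x by lra.
have : `|a| <= 1 / 3 * x by rewrite -(ler_pXn2r (n := 2)) ?nnegrE // real_normK ?num_real.
(* With [|a| <= x / 3] and [y <= x], the left factor [(x + a) ^ 2] is at least [4/9 * x ^ 2], while
   only [2/9 * x ^ 2] is required. *)
by rewrite ler_norml => /andP[a1 a2]; nra.
Qed.

Lemma cos2Zr c u v : c != 0 -> cos2 v (c *: u) = cos2 v u.
Proof. by move=> c0; rewrite cos2C cos2Zl // cos2C. Qed.

(** Rescaling reduces to [w = u + v]; the longer summand then plays the part of [v] in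
    [cos2_plane_aux]. *)
Lemma cos2_coplanar a b u v w : a != 0 -> b != 0 -> w = a *: u + b *: v ->
  w != 0 -> 1 / 12 <= cos2 u v + cos2 u w + cos2 v w.
Proof.
move=> a0 b0 ew w0.
have sym x y : x + y != 0 -> nsq y <= nsq x ->
    1 / 12 <= cos2 x y + cos2 x (x + y) + cos2 y (x + y).
  move=> xy0 le; rewrite (le_trans (cos2_plane_aux xy0 le)) //.
  by rewrite (cos2C x (x + y)) lerDl cos2_ge0.
have -> : cos2 u v = cos2 (a *: u) (b *: v) by rewrite cos2Zl // cos2Zr.
rewrite -(cos2Zl u w a0) -(cos2Zl v w b0); rewrite ew in w0 *.
have [le|/ltW le] := leP (nsq (b *: v)) (nsq (a *: u)); first exact: sym.
rewrite (cos2C (a *: u) (b *: v)) addrAC; rewrite addrC in w0.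
by rewrite (addrC (a *: u)); apply: sym.
Qed.

End Hermitian.

(** * Radial position *)

(** Two block-triangular factorizations of the matrix with blocks [1], [u], [v], [1] have these
    determinants. *)
Lemma det_1Bmul (K : comNzRingType) d (u : 'cV[K]_d) (v : 'rV[K]_d) :
  \det (1%:M - u *m v) = 1 - (v *m u) 0 0.
Proof.
have e : block_mx 1%:M 0 v 1%:M *m block_mx 1%:M u 0 (1%:M - v *m u)
       = block_mx (1%:M - u *m v) u 0 1%:M *m block_mx 1%:M 0 v 1%:M.
  rewrite !mulmx_block !mulmx0 !mul0mx !mulmx1 !mul1mx !addr0 !add0r.
  by rewrite subrK [v *m u + _]addrC subrK.
have := congr1 (fun M => \det M) e.
rewrite /= !det_mulmx !det_ublock !det_lblock !det1 !mulr1 !mul1r => <-.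
by rewrite det_mx11 !mxE eqxx.
Qed.

Lemma nsqc_sum_le (R : realType) (T : Type) (r : seq T) (F : T -> R[i]) :
  nsqc (\sum_(i <- r) F i) <= 2 ^+ size r * \sum_(i <- r) nsqc (F i).
Proof.
elim: r => [|i r IH]; first by rewrite !big_nil mulr0 /nsqc /= expr0n addr0.
rewrite !big_cons /= exprS.
set S := \sum_(j <- r) nsqc (F j) in IH *.
have S0 : 0 <= S by apply: sumr_ge0 => j _; apply: nsqc_ge0.
have p1 : 1 <= 2 ^+ size r :> R by rewrite exprn_ege1 // ler1n.
have h (a b : R[i]) : nsqc (a + b) <= 2 * nsqc a + 2 * nsqc b.
  case: a b => [a a'] [b b']; rewrite /nsqc /=.
  by have := sqr_ge0 (a - b); have := sqr_ge0 (a' - b'); nra.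
apply: (le_trans (h _ _)).
by have := nsqc_ge0 (F i); nra.
Qed.

(** A crude Hadamard inequality from the Leibniz expansion, each term of which takes one entry per
    row. What counts is that [K] does not depend on [W]. *)
Lemma nsqc_det_le (R : realType) d :
  exists2 K : R, 0 < K & forall W : 'M[R[i]]_d,
    nsqc (\det W) <= K * \prod_i nsq (row i W).
Proof.
pose N := size (index_enum {perm 'I_d}).
exists (2 ^+ N * N.+1%:R) => [|W]; first by rewrite mulr_gt0 ?exprn_gt0 ?ltr0n.
apply: (le_trans (nsqc_sum_le _ _)); rewrite -mulrA ler_pM2l ?exprn_gt0 ?ltr0n//.
have P0 : 0 <= \prod_i nsq (row i W) by apply: prodr_ge0 => i _; apply: nsq_ge0.
apply: (@le_trans _ _ (\sum_(s <- index_enum {perm 'I_d}) \prod_i nsq (row i W))).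
  apply: ler_sum => s _; rewrite nsqcM.
  have -> : nsqc ((-1) ^+ s : R[i]) = 1.
    by case: (s : bool); rewrite /nsqc /= ?expr1 ?expr0 /= ?sqrrN; ring.
  rewrite mul1r (big_morph _ (@nsqcM R) (_ : nsqc 1 = 1)); last first.
    by rewrite /nsqc /=; ring.
  apply: ler_prod => i _; rewrite nsqc_ge0 /= /nsq.
  rewrite (bigD1 (s i)) //= mxE lerDl sumr_ge0 // => j _; exact: nsqc_ge0.
rewrite big_const_seq count_predT -/N iter_addr_0 -[leLHS]mulr_natl.
by rewrite ler_wpM2r // ler_nat.
Qed.

Lemma dim_addv_line (K : fieldType) (E : vectType K) (Q : {vspace E}) (x : E) :
  x \notin Q -> \dim (Q + <[x]>) = (\dim Q).+1.
Proof.
move=> xQ; rewrite dimv_disjoint_sum ?dim_vline.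
  by rewrite (_ : x != 0) ?addn1 //; apply: contraNneq xQ => ->; apply: mem0v.
apply/eqP; rewrite -subv0; apply/subvP => y /memv_capP[yQ /vlineP[c ec]].
rewrite memv0 ec; have [->|c0] := eqVneq c 0; first by rewrite scale0r.
by case/negP: xQ; rewrite -(scalerK c0 x) -ec memvZ.
Qed.

(** Summation by parts along an increasing order of [y]. A vector enters the basis [b] when it
    enlarges the span. By [dens] the coefficient of [Y] is nonpositive, which lets [Y] grow from one
    step to the next. *)
Lemma abel_greedy (R : realType) (K : fieldType) (E : vectType K) (I : finType)
    (v : I -> E) (A : {set I}) (d n : nat) (y : I -> R) :
    (forall p : seq I, uniq p -> {subset p <= A} ->
       (size p * d <= n * \dim <<map v p>>)%N) ->
  forall s, uniq s -> {subset s <= A} -> pairwise (relpre y <=%R) s ->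
  exists b : seq I, [/\ {subset b <= s}, free (map v b), (<<map v b>> = <<map v s>>)%VS &
    forall Y, (forall i, i \in s -> y i <= Y) ->
      ((size s * d)%:R - (n * \dim <<map v s>>)%:R) * Y
        <= d%:R * (\sum_(i <- s) y i) - n%:R * (\sum_(i <- b) y i)].
Proof.
move=> dens; elim/last_ind => [|s i IH].
  move=> _ _ _; exists [::]; split => //; first exact: nil_free.
  by move=> Y _; rewrite /= span_nil dimv0 !big_nil muln0 mul0n subrr mul0r !mulr0 subrr.
move=> us sA; have ds := dens _ us sA.
move: us; rewrite rcons_uniq pairwise_rcons => /andP[is_ us] /andP[ys ps].
have [|b [bs fb eb hb]] := IH us _ ps.
  by move=> j js; apply: sA; rewrite mem_rcons inE js orbT.
(* Sortedness makes [y i] an upper bound for the weights met so far. *)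
have {hb} := hb (y i) (fun j js => allP ys j js).
have espan : (<<map v (rcons s i)>> = <<map v s>> + <[v i]>)%VS.
  by rewrite map_rcons -cats1 span_cat span_seq1.
have [vi|vi] := boolP (v i \in <<map v s>>%VS).
  have e2 : (<<map v (rcons s i)>> = <<map v s>>)%VS.
    by rewrite espan; apply/addv_idPl; rewrite -memvE.
  move=> hb; exists b; split => //.
  - by move=> j /bs js; rewrite mem_rcons inE js orbT.
  - by rewrite e2.
  move=> Y hY; rewrite e2 in ds *; rewrite size_rcons in ds *.
  rewrite -cats1 big_cat big_seq1 /=.
  have yY : y i <= Y by apply: hY; rewrite mem_rcons inE eqxx.
  move: ds; rewrite -(ler_nat R) mulSn !natrD => ds.
  by nra.
have e2 : \dim <<map v (rcons s i)>> = (\dim <<map v s>>).+1.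
  by rewrite espan dim_addv_line.
move=> hb; exists (rcons b i); split => //.
- move=> j; rewrite !mem_rcons !inE => /orP[->//|/bs ->]; exact: orbT.
- have -> : free (map v (rcons b i)) = free (v i :: map v b).
    by apply: perm_free; rewrite map_rcons perm_rcons.
  rewrite free_cons fb andbT.
  by rewrite eb.
- by rewrite espan map_rcons -cats1 span_cat span_seq1 eb.
move=> Y hY; rewrite e2 in ds *; rewrite size_rcons in ds *.
rewrite -!cats1 !big_cat !big_seq1 /=.
have yY : y i <= Y by apply: hY; rewrite mem_rcons inE eqxx.
move: ds; rewrite -(ler_nat R) mulSn mulnS !natrD => ds.
by nra.
Qed.

Section RadialPosition.
Variables (R : realType) (d : nat) (I : finType) (v : I -> 'rV[R[i]]_d).
Variable A : {set I}.
Hypotheses (d_gt0 : (0 < d)%N) (A_gt0 : (0 < #|A|)%N).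
Hypothesis dens : forall U : {vspace 'rV[R[i]]_d},
  (#|[set i in A | v i \in U]| * d <= #|A| * \dim U)%N.

Lemma dens_neq0 i : i \in A -> v i != 0.
Proof.
move=> iA; apply/negP => /eqP vi; have := dens 0%VS.
rewrite dimv0 muln0 leqn0 muln_eq0 [d == _]gtn_eqF // orbF cards_eq0 => /eqP/setP/(_ i).
by rewrite !inE iA vi mem0v.
Qed.

Lemma dens_seq (p : seq I) : uniq p -> {subset p <= A} ->
  (size p * d <= #|A| * \dim <<map v p>>)%N.
Proof.
move=> up pA; apply: leq_trans (dens _); rewrite leq_mul2r; apply/orP; right.
rewrite -(card_uniqP up); apply: subset_leq_card; apply/subsetP => i ip.
by rewrite inE pA //= memv_span // map_f.
Qed.

(** The factors [d] and [#|A|] make this invariant under scaling an invertible [T]. *)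
Definition pot (T : 'M[R[i]]_d) : R :=
  d%:R * \sum_(i in A) ln (nsq (v i *m T)) - #|A|%:R * ln (nsqc (\det T)).

Lemma nsqc_gt0 (z : R[i]) : (0 < nsqc z) = (z != 0).
Proof. by rewrite lt_def nsqc_ge0 andbT nsqc_eq0. Qed.

Lemma mulmx_neq0 T i : T \in unitmx -> i \in A -> v i *m T != 0.
Proof.
move=> uT iA; apply: contra (dens_neq0 iA) => /eqP h.
by rewrite -(mulmxK uT (v i)) h mul0mx.
Qed.

(** The sum of [y] over a greedy basis, times [#|A|], bounds the first term of [pot T] from below.
    Hadamard's bound for the images of that basis then cancels [\det T]. *)
Lemma pot_lower : exists c, forall T, T \in unitmx -> c <= pot T.
Proof.
have [K K0 hK] := nsqc_det_le R d.
pose M (t : d.-tuple I) : 'M[R[i]]_d := \matrix_i v (tnth t i).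
(* Summing over all tuples makes the constant independent of the basis, which varies with [T]. *)
exists (- #|A|%:R * (\sum_t `|ln (nsqc (\det (M t)))| + ln K)) => T uT.
pose y i := ln (nsq (v i *m T)).
pose s := sort (relpre y <=%R) (enum A).
have tot : total (relpre y <=%R) by move=> i j; exact: le_total.
have tr : transitive (relpre y <=%R) by move=> i j k /=; exact: le_trans.
have us : uniq s by rewrite sort_uniq enum_uniq.
have ms : s =i A by move=> i; rewrite mem_sort mem_enum.
have ss : pairwise (relpre y <=%R) s by rewrite -(sorted_pairwise tr) sort_sorted.
have sz : size s = #|A| by rewrite size_sort cardE.
have [b [bs fb eb hb]] := abel_greedy dens_seq us (fun i => etrans (esym (ms i))) ss.
have edim : \dim <<map v s>> = d.
  apply/eqP; rewrite eqn_leq; apply/andP; split.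
    by apply: leq_trans (dimvS (subvf _)) _; rewrite dimvf /dim /= mul1n.
  have := dens_seq us (fun i => etrans (esym (ms i))).
  by rewrite sz leq_pmul2l.
have sb : size b == d by rewrite -edim -eb -(size_map v) eq_sym.
(* Any common upper bound of the weights will do, since its coefficient is zero. *)
have {hb} := hb (\sum_(i <- s) `|y i|) _; rewrite edim sz subrr mul0r.
have -> : \sum_(i <- s) y i = \sum_(i in A) y i.
  by rewrite (perm_big _ (permEl (perm_sort _ _))) big_enum.
have {sb} [t et] : exists t : d.-tuple I, b = t by exists (Tuple sb).
rewrite et in fb * => {b bs eb et} hb.
have {}hb : #|A|%:R * \sum_i y (tnth t i) <= d%:R * \sum_(i in A) y i.
  have <- : \sum_(i <- t) y i = \sum_i y (tnth t i) by exact: big_tuple.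
  rewrite -subr_ge0; apply: hb => i is_.
  by apply: le_trans (ler_norm _) _; rewrite (big_rem i) //= lerDl sumr_ge0.
have dM : \det (M t) != 0.
  apply/det0P => -[c c0 ec]; case/negP: c0; apply/eqP/rowP => i; rewrite mxE.
  have/freeP : free (map_tuple v t) by [].
  apply; rewrite -[RHS]ec mulmx_sum_row; apply: eq_bigr => j _.
  by rewrite rowK (nth_map (tnth t j)) ?size_tuple // -tnth_nth.
have dT : \det T != 0 by rewrite -unitfE -unitmxE.
have hl : ln (nsqc (\det (M t))) + ln (nsqc (\det T)) <= ln K + \sum_i y (tnth t i).
  have row_gt0 i : 0 < nsq (row i (M t *m T)).
    rewrite nsq_gt0; apply/negP => /eqP ri; have : M t *m T \in unitmx.
      by rewrite unitmx_mul uT unitmxE unitfE dM.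
    rewrite -row_free_unit => /row_freeP[B eB].
    have := congr1 (row i) eB; rewrite row_mul ri mul0mx row1 => /rowP/(_ i).
    by rewrite !mxE !eqxx => /esym/eqP; rewrite oner_eq0.
  have [pr_gt0 <-] : 0 < \prod_i nsq (row i (M t *m T)) /\
      ln (\prod_i nsq (row i (M t *m T))) = \sum_i y (tnth t i).
    apply: (big_ind2 (fun p (q : R) => 0 < p /\ ln p = q)).
    - by rewrite ln1.
    - by move=> p1 q1 p2 q2 [? <-] [? <-]; rewrite mulr_gt0 // lnM.
    - by move=> i _; rewrite row_gt0 row_mul rowK.
  rewrite -!lnM ?posrE ?nsqc_gt0 // ler_ln ?posrE ?mulr_gt0 ?nsqc_gt0 //.
  by rewrite -nsqcM -det_mulmx.
have hS : - \sum_t `|ln (nsqc (\det (M t)))| <= ln (nsqc (\det (M t))).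
  rewrite lerNl (bigD1 t) //= -normrN (le_trans (ler_norm _)) // lerDl sumr_ge0 //.
  have n0 : 0 < #|A|%:R :> R by rewrite ltr0n.
have -> : pot T = d%:R * (\sum_(i in A) y i) - #|A|%:R * ln (nsqc (\det T)) by [].
set S := \sum_t _ in hS *; set D := d%:R * _ in hb *; set sy := \sum_i _ in hb hl.
move: (ln K) (ln (nsqc (\det (M t)))) (ln (nsqc (\det T))) hl hS => k a a' hl hS.
rewrite mulNr lerNl opprB lerBlDr; apply: le_trans (lerD (lexx _) hb).
by rewrite -mulrDr ler_pM2l //; lra.
Qed.

(** Halving the component along [w] lowers the first term of [pot] by more than [3/4 * 4 * #|A|]. It
    also halves the determinant, which costs [#|A| * ln 4], at most [2 * #|A|]. The net loss exceeds
    [#|A| >= 1]. *)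
Lemma pot_step T j : T \in unitmx -> j \in A ->
  4 * #|A|%:R < d%:R * \sum_(i in A) cos2 (v i *m T) (v j *m T) ->
  exists2 T', T' \in unitmx & pot T' <= pot T - 1.
Proof.
move=> uT jA big; set w := v j *m T.
have w0 : w != 0 by apply: mulmx_neq0.
have nw : nsq w != 0 by rewrite nsq_eq0.
(* Chosen so that right multiplication by [1%:M - u *m w] halves the component along [w]. *)
pose u : 'cV[R[i]]_d := \col_k ((w 0 k)^*%C / (2 * (nsq w)%:C%C)).
have xu (x : 'rV_d) : x *m u = (ip x w / (2 * (nsq w)%:C%C))%:M.
  apply/rowP => k; rewrite (ord1 k) !mxE eqxx mulr1n /ip mulr_suml.
  by apply: eq_bigr => l _; rewrite mxE mulrA.
pose T' := T *m (1%:M - u *m w).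
have eT' i : v i *m T' = v i *m T - (ip (v i *m T) w / (2 * (nsq w)%:C%C)) *: w.
  by rewrite mulmxA mulmxBr mulmx1 mulmxA xu mul_scalar_mx.
have nwC : (nsq w)%:C%C != 0 :> R[i] by rewrite eq_complex /= eqxx andbT.
have dP : \det (1%:M - u *m w) = (1 / 2 : R)%:C%C.
  rewrite det_1Bmul xu mxE eqxx mulr1n ipE fmorph_div /= rmorph1 rmorph_nat.
  by field; rewrite nwC.
have uT' : T' \in unitmx.
  rewrite unitmx_mul uT /= unitmxE dP unitfE eq_complex /= eqxx andbT.
  by rewrite gt_eqF // divr_gt0.
exists T' => //.
have n0 : 1 <= #|A|%:R :> R by rewrite ler1n.
have hx i : i \in A -> ln (nsq (v i *m T')) <=
    ln (nsq (v i *m T)) - 3 / 4 * cos2 (v i *m T) w.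
  move=> iA; have x0 := mulmx_neq0 uT iA; have x0' := mulmx_neq0 uT' iA.
  have e : nsq (v i *m T') = nsq (v i *m T) * (1 + - (3 / 4 * cos2 (v i *m T) w)).
    rewrite eT' nsq_shrink // /cos2; field.
    by rewrite nw nsq_eq0 x0.
  have p1 : 0 < nsq (v i *m T) by rewrite nsq_gt0.
  have p2 : 0 < 1 + - (3 / 4 * cos2 (v i *m T) w).
    by rewrite -(pmulr_rgt0 _ p1) -e nsq_gt0.
  rewrite e lnM ?posrE // lerD2l le_ln1Dx //; lra.
have eln : ln (nsqc (\det T')) = ln (nsqc (\det T)) + ln (1 / 4).
  have dT : \det T != 0 by rewrite -unitfE -unitmxE.
  rewrite det_mulmx nsqcM dP nsqc_real lnM ?posrE ?nsqc_gt0 //; last first.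
    by rewrite exprn_gt0 // divr_gt0.
  by congr (_ + ln _); field.
have l4 : - 2 <= ln (1 / 4 : R).
  have -> : 1 / 4 = (2 * 2)^-1 :> R by field.
  rewrite lnV ?posrE ?mulr_gt0 // lnM ?posrE //.
  have : ln (1 + 1 : R) <= 1 by apply: le_ln1Dx; lra.
  rewrite (_ : 1 + 1 = 2) //; lra.
have hs : \sum_(i in A) ln (nsq (v i *m T')) <=
    \sum_(i in A) ln (nsq (v i *m T)) - 3 / 4 * \sum_(i in A) cos2 (v i *m T) w.
  by rewrite mulr_sumr -sumrB; apply: ler_sum => i /hx.
have d0 : 0 <= d%:R :> R by [].
have := ler_wpM2l d0 hs; rewrite /pot eln; move: big; rewrite -/w mulrBr.
move: (\sum_(i in A) cos2 _ _) (ln (nsqc _)) => c a.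
move: (\sum_(i in A) _) (\sum_(i in A) _) => s s' big.
rewrite (mulrCA d%:R (3 / 4)).
by move: (d%:R * c) (d%:R * s) (d%:R * s') big => x y z big; nra.
Qed.

(* [pot] decreases by at least 1 as long as the conclusion fails, but it is
   bounded below. *)
Lemma radial_position : exists2 T : 'M[R[i]]_d, T \in unitmx &
  forall j, j \in A ->
    d%:R * \sum_(i in A) cos2 (v i *m T) (v j *m T) <= 4 * #|A|%:R.
Proof.
have [c hc] := pot_lower.
apply: contrapT => nT.
have step T : T \in unitmx -> exists2 T', T' \in unitmx & pot T' <= pot T - 1.
  move=> uT; apply: contrapT => nT'; apply: nT; exists T => // j jA.
  by rewrite leNgt; apply/negP => big; apply: nT'; apply: pot_step jA big.
have iter k : exists2 T, T \in unitmx & pot T <= pot 1%:M - k%:R.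
  elim: k => [|k [T uT hT]]; first by exists 1%:M; rewrite ?unitmx1 ?subr0.
  have [T' uT' hT'] := step T uT; exists T' => //.
  by rewrite -natr1; lra.
have [k hk] : exists k : nat, pot 1%:M - c < k%:R.
  exists (Num.bound `|pot 1%:M - c|); apply: le_lt_trans (ler_norm _) _.
  exact: archi_boundP (normr_ge0 _).
have [T uT hT] := iter k; have := hc T uT; lra.
Qed.

End RadialPosition.

(** * Counting collinear triples *)

Section TripleCount.
Variables (R : realFieldType) (I : finType) (col : I -> I -> I -> bool).
Variables (g : I -> I -> R) (c : R).
Hypothesis col12 : forall i j k, col i j k -> col j i k.
Hypothesis col23 : forall i j k, col i j k -> col i k j.
Hypothesis col_neq : forall i j k, col i j k -> k != j.
Hypothesis col_trans : forall i j k l, col i j k -> col i j l -> l != k -> col i k l.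
Hypothesis g_col : forall i j k, col i j k -> c <= g i j + g i k + g j k.

Let N i j := #|[set l | col i j l]|.

Let N_sym i j : N i j = N j i.
Proof. by apply: eq_card => l; rewrite !inE; apply/idP/idP; apply: col12. Qed.

(** The pairs [i j] and [i k] span the same line; their sets of third points differ by exchanging
    [k] for [j]. *)
Let N_col i j k : col i j k -> N i j = N i k.
Proof.
move=> ijk; have ikj := col23 ijk.
rewrite /N (cardsD1 k) inE ijk [RHS](cardsD1 j) inE ikj; congr (_ + _)%N.
apply: eq_card => l; rewrite !inE; apply/andP/andP => -[lk].
  by move=> ijl; rewrite (col_neq ijl) (col_trans ijk).
by move=> ikl; rewrite (col_neq ikl) (col_trans ikj).
Qed.

(* Each pair [i j] distributes its weight [g i j] evenly among the triples of
   its line. *)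
Lemma triple_weight :
  c * \sum_i #|[set j | [exists k, col i j k]]|%:R
    <= 3 * \sum_i \sum_(j | [exists k, col i j k]) g i j.
Proof.
pose F i j k := if col i j k then g i j / (N i j)%:R else 0.
have col13 i j k : col i j k = col j k i.
  by apply/idP/idP => [/col12/col23|/col23/col12].
have spread (f : I -> I -> R) : \sum_i \sum_(j | [exists k, col i j k]) f i j =
    \sum_i \sum_j \sum_k (if col i j k then f i j / (N i j)%:R else 0).
  apply: eq_bigr => i _; rewrite big_mkcond; apply: eq_bigr => j _.
  rewrite -big_mkcond sumr_const; case: existsP => [[k ijk]|nk].
    have -> : #|[pred k | col i j k]| = N i j by apply: eq_card => l; rewrite !inE.
    rewrite -[RHS]mulr_natr divfK // pnatr_eq0 -lt0n.
    by apply/card_gt0P; exists k; rewrite inE.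
  rewrite eq_card0 ?mulr0n // => k; rewrite !inE; apply/negbTE/negP => ijk.
  by apply: nk; exists k.
(* The same sum is written three times, with the weight on each of the three pairs of a triple, so
   that [g_col] applies triple by triple. *)
have S1 := spread g.
have S2 : \sum_i \sum_(j | [exists k, col i j k]) g i j =
    \sum_i \sum_j \sum_k (if col i j k then g i k / (N i k)%:R else 0).
  rewrite S1; apply: eq_bigr => i _; rewrite exchange_big; apply: eq_bigr => j _.
  apply: eq_bigr => k _; suff -> : col i k j = col i j k by [].
  by apply/idP/idP; apply: col23.
have S3 : \sum_i \sum_(j | [exists k, col i j k]) g i j =
    \sum_i \sum_j \sum_k (if col i j k then g j k / (N j k)%:R else 0).
  rewrite S1 [RHS]exchange_big; apply: eq_bigr => i _; rewrite [RHS]exchange_big.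
  by apply: eq_bigr => j _; apply: eq_bigr => k _; rewrite (col13 k).
have -> : c * \sum_i #|[set j | [exists k, col i j k]]|%:R =
    \sum_i \sum_j \sum_k (if col i j k then c / (N i j)%:R else 0).
  rewrite -(spread (fun _ _ => c)) mulr_sumr; apply: eq_bigr => i _.
  rewrite sumr_const -[RHS]mulr_natr; congr (_ * _%:R).
  by apply: eq_card => j; rewrite !inE.
rewrite (_ : 3 = 1 + 1 + 1) ?mulrDl ?mul1r; last by ring.
rewrite {1}S1 {1}S2 S3 -!big_split; apply: ler_sum => i _.
rewrite -!big_split; apply: ler_sum => j _.
rewrite -!big_split; apply: ler_sum => k _ /=.
case: ifP => [ijk|_]; last by rewrite !addr0.
have e1 := N_col ijk; have e2 : N i j = N j k.
  by rewrite N_sym; apply: N_col; apply: col12.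
by rewrite -e1 -e2 -!mulrDl ler_wpM2r ?invr_ge0 // g_col.
Qed.

End TripleCount.

(** * Exchange and coordinates modulo a subspace *)

Section Quotient.
Variables (K : fieldType) (E : vectType K).
Implicit Types (U H W : {vspace E}) (x y : E).

Lemma memv_exchange U x y :
  x \in (U + <[y]>)%VS -> x \notin U -> y \in (U + <[x]>)%VS.
Proof.
case/memv_addP => u uU [_ /vlineP[a ->] ->] nU.
have a0 : a != 0 by apply: contraNneq nU => ->; rewrite scale0r addr0.
have ey : y = - (a^-1 *: u) + a^-1 *: (u + a *: y).
  by rewrite scalerDr scalerK // addKr.
rewrite {1}ey; apply: memv_add; last by rewrite rpredZ ?memv_line.
by rewrite rpredN rpredZ.
Qed.

(** Coordinates on a complement of [H] in [W] replace the quotient [W / H], which makes the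
    hermitian product of row vectors available. *)
Lemma quotient_map H W : (H <= W)%VS ->
  exists (d : nat) (f : 'Hom(E, 'rV[K]_d)),
    (d + \dim H)%N = \dim W /\ (W :&: lker f)%VS = H.
Proof.
move=> HW; pose U := (W :\: H)%VS.
have eW : (U + H)%VS = W by rewrite addv_diff; apply/addv_idPl.
have UH : (U :&: H = 0)%VS by apply: capv_diff.
have HU : (H :&: U = 0)%VS by rewrite capvC.
pose p x : 'rV[K]_(\dim U) := \row_i coord (vbasis U) i (daddv_pi U H x).
have lp : linear p by move=> a x y; apply/rowP => i; rewrite !mxE !linearP.
pose p' : {linear E -> 'rV[K]_(\dim U)} := HB.pack p (GRing.isLinear.Build _ _ _ _ p lp).
exists (\dim U), (linfun p'); split.
  by rewrite -(dimv_disjoint_sum UH) eW.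
apply/vspaceP => x; rewrite memv_cap memv_ker (lfunE p' x) -/(p x).
apply/andP/idP => [[xW /eqP px]|xH].
  rewrite -(daddv_pi_add UH (_ : x \in (U + H)%VS)) ?eW //.
  suff -> : daddv_pi U H x = 0 by rewrite add0r memv_pi.
  rewrite (coord_vbasis (memv_pi U H x)) big1 // => i _.
  by have /rowP/(_ i) := px; rewrite !mxE => ->; rewrite scale0r.
split; first exact: (subvP HW).
have xW : x \in (U + H)%VS by rewrite eW (subvP HW).
have := daddv_pi_add UH xW; rewrite (daddv_pi_id HU xH) => /(canRL (addrK _)).
rewrite subrr => px; apply/eqP/rowP => i; by rewrite !mxE px linear0.
Qed.

End Quotient.

(** * Quotients of minimal outer density *)

Section SylvesterGallai.
Variables (R : realType) (E : vectType R[i]) (I : finType) (v : I -> E).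
Implicit Types (Q U : {vspace E}) (A B : {set I}).

Definition spn A : {vspace E} := (\sum_(i in A) <[v i]>)%VS.

Lemma memv_spn A i : i \in A -> v i \in spn A.
Proof. by move=> iA; rewrite memvE; apply: (sumv_sup i). Qed.

Lemma spn_subv A U : (forall i, i \in A -> v i \in U) -> (spn A <= U)%VS.
Proof. by move=> h; apply/subv_sumP => i /h; rewrite memvE. Qed.

Lemma spnS A B : A \subset B -> (spn A <= spn B)%VS.
Proof. by move=> /subsetP AB; apply: spn_subv => i /AB; apply: memv_spn. Qed.

Definition outside A U := [set i in A | v i \notin U].

(* Minimizing the density of the points outside a proper subspace [H] makes the
   quotient by [H] satisfy the hypothesis of [radial_position]. *)
Lemma dense_quotient Q A (W := (Q + spn A)%VS) : (\dim Q < \dim W)%N ->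
  exists (d : nat) (f : 'Hom(E, 'rV[R[i]]_d)) (H : {vspace E}),
  let A1 := outside A H in
  [/\ (0 < d)%N, (0 < #|A1|)%N, (Q <= H)%VS & (W :&: lker f)%VS = H] /\
  [/\ (#|A1| * (\dim W - \dim Q) <= #|A| * d)%N &
   forall X : {vspace 'rV[R[i]]_d},
     (#|[set i in A1 | f (v i) \in X]| * d <= #|A1| * \dim X)%N].
Proof.
move=> QW; pose Hs B := (Q + spn B)%VS.
(* Only subspaces generated by [Q] and points of [A] compete, so a minimum exists by finiteness; [P]
   keeps the denominator of [r] positive. *)
pose P B := (B \subset A) && (\dim (Hs B) < \dim W)%N.
pose r B : rat := #|outside A (Hs B)|%:R / (\dim W - \dim (Hs B))%N%:R.
have spn0 : spn set0 = 0%VS by rewrite /spn big_set0.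
have P0 : P set0 by rewrite /P sub0set /Hs spn0 addv0.
pose B := [arg min_(B < set0 | P B) r B]%O.
have [/andP[BA dB] minB] : P B /\ forall B', P B' -> r B <= r B'.
  by rewrite /B; case: arg_minP.
pose H := Hs B; pose d := (\dim W - \dim H)%N; pose A1 := outside A H.
have HW : (H <= W)%VS by rewrite /H /Hs /W addvS ?spnS.
have QH : (Q <= H)%VS by apply: addvSl.
have [d' [f [ed' kf]]] := quotient_map HW.
have ed : d' = d by rewrite /d -ed' addnK.
have d_gt0 : (0 < d')%N by rewrite ed subn_gt0.
have rB : r B = #|A1|%:R / d'%:R by rewrite ed.
have d0 : (0 : rat) < d'%:R by rewrite ltr0n.
have A1_gt0 : (0 < #|A1|)%N.
  rewrite lt0n; apply: contraTneq dB => /eqP; rewrite cards_eq0 => /eqP A10.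
  rewrite -leqNgt dimvS // /W subv_add QH; apply: spn_subv => i iA.
  by apply: contraT => nH; have := in_set0 i; rewrite -A10 inE iA nH.
exists d', f, H; split; first by [].
split.
  have := minB _ P0; rewrite rB /r /Hs spn0 addv0.
  have q0 : (0 : rat) < (\dim W - \dim Q)%N%:R by rewrite ltr0n subn_gt0.
  rewrite ler_pdivrMr // mulrAC ler_pdivlMr // -!natrM ler_nat => /leq_trans; apply.
  by rewrite leq_mul2r subset_leq_card ?orbT //;
     apply/subsetP => i; rewrite inE => /andP[].
move=> X; set S := [set i in A1 | f (v i) \in X].
have SA1 : S \subset A1 by apply/subsetP => i; rewrite inE => /andP[].
have SA : S \subset A by apply: subset_trans SA1 _;
  apply/subsetP => i; rewrite inE => /andP[].
(* The competitor to test against [X] is [H] enlarged by the points that [f] sends into [X]. *)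
have eH2 : Hs (B :|: S) = (H + spn S)%VS.
  rewrite /H /Hs -addvA; congr (_ + _)%VS; apply/eqP.
  rewrite eqEsubv subv_add !spnS ?subsetUl ?subsetUr // !andbT.
  apply: spn_subv => i; rewrite inE => /orP[]iS.
    by apply: (subvP (addvSl _ _)); apply: memv_spn.
  by apply: (subvP (addvSr _ _)); apply: memv_spn.
have H2W : (H + spn S <= W)%VS.
  by rewrite subv_add HW /= /W; apply: subv_trans (spnS SA) (addvSr _ _).
have dX : (\dim (H + spn S) <= \dim H + \dim X)%N.
  rewrite -(limg_ker_dim f (H + spn S)) leq_add //; apply: dimvS.
    by rewrite -[X in (_ <= X)%VS]kf capvS.
  rewrite limgD subv_add; apply/andP; split.
    rewrite (_ : f @: H = 0)%VS ?sub0v //; apply/eqP; rewrite -lkerE -[X in (X <= _)%VS]kf.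
    exact: capvSr.
  rewrite /spn limg_sum; apply/subv_sumP => i; rewrite limg_line inE => /andP[_ fX].
  by rewrite -memvE.
have cA1 : (#|outside A (H + spn S)| + #|S| <= #|A1|)%N.
  rewrite -(cardsID S A1) addnC (setIidPr SA1) leq_add2l.
  apply: subset_leq_card; apply/subsetP => i; rewrite !inE => /andP[iA ni].
  rewrite iA /=; apply/andP; split; last first.
    by apply: contra ni; apply: (subvP (addvSl _ _)).
  rewrite negb_and; apply/orP; right; apply: contra ni => fX.
  case/boolP: (v i \in H) => [|nH]; first by apply: (subvP (addvSl _ _)).
  by apply: (subvP (addvSr _ _)); apply: memv_spn; rewrite !inE iA nH.
(* If the enlarged subspace fills [W], it is no competitor, but then [\dim X >= d'] and the count is
   immediate. *)
have [lt2|ge2] := ltnP (\dim (H + spn S)) (\dim W); last first.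
  by apply: leq_mul; [apply: subset_leq_card | lia].
have := minB (B :|: S); rewrite /P eH2 lt2 subUset BA SA /= => /(_ isT).
rewrite rB /r eH2.
have q0 : (0 : rat) < (\dim W - \dim (H + spn S))%N%:R by rewrite ltr0n subn_gt0.
rewrite ler_pdivrMr // mulrAC ler_pdivlMr // -!natrM ler_nat.
have hd : (\dim W - \dim (H + spn S) + \dim X >= d')%N by lia.
move: cA1 hd; set a := #|A1|; set o := #|outside _ _|; set s := #|S|.
set w := (\dim W - _)%N; set x := \dim X => cA1 hd hh.
nia.
Qed.

End SylvesterGallai.

(** * Sylvester-Gallai configurations of lines *)

Section SylvesterGallai1.
Variables (R : realType) (E : vectType R[i]) (I : finType) (v : I -> E).
Implicit Types (Q U : {vspace E}) (A B : {set I}).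

(** Modulo [Q], the vectors stand for distinct points of a projective space. *)
Definition nonparallel Q A :=
  (forall i, i \in A -> v i \notin Q) /\
  (forall i j, i \in A -> j \in A -> i != j -> v i \notin (Q + <[v j]>)%VS).

Definition collinear Q A i j k :=
  [&& [&& i \in A, j \in A & k \in A], [&& i != j, k != i & k != j] &
      v k \in (Q + <[v i]> + <[v j]>)%VS].

Lemma collinear12 Q A i j k : collinear Q A i j k -> collinear Q A j i k.
Proof.
case/and3P=> /and3P[iA jA kA] /and3P[ij ki kj] vk; apply/and3P; split;
  [exact/and3P | by apply/and3P; split=> //; rewrite eq_sym |].
by rewrite -addvA (addvC <[v j]>%VS) addvA.
Qed.

Lemma collinear23 Q A i j k : nonparallel Q A ->
  collinear Q A i j k -> collinear Q A i k j.
Proof.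
move=> [_ np] /and3P[/and3P[iA jA kA] /and3P[ij ki kj] vk]; apply/and3P; split;
  [exact/and3P | by apply/and3P; split=> //; rewrite eq_sym |].
by apply: memv_exchange vk _; apply: np.
Qed.

Lemma collinear_trans Q A i j k l : nonparallel Q A ->
  collinear Q A i j k -> collinear Q A i j l -> l != k -> collinear Q A i k l.
Proof.
move=> np ijk /and3P[/and3P[_ _ lA] /and3P[_ li lj] vl] lk.
have /and3P[/and3P[iA kA jA] /and3P[ik ji jk] vj] := collinear23 np ijk.
apply/and3P; split; [exact/and3P|exact/and3P|].
apply: subvP vl; rewrite subv_add addvSl /=.
by rewrite -memvE.
Qed.

Lemma collinear_line Q A i j k H : nonparallel Q A -> (Q <= H)%VS ->
  collinear Q A i j k -> v i \in H -> v j \in H -> v k \in H.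
Proof.
move=> np QH /and3P[/and3P[iA jA kA] /and3P[ij ki kj] vk] iH jH; apply: subvP vk.
by rewrite !subv_add QH -!memvE iH jH.
Qed.

(** Radial position bounds the sum of [cos2] over pairs from above and [triple_weight] bounds it
    from below, which limits the dimension [d] of the quotient by [H]. Minimal density carries this
    over to [W] modulo [Q]. *)
Lemma sg1_bound Q A (h : R) : 0 < h -> nonparallel Q A ->
  (forall i, i \in A ->
     h <= #|[set j in A | (j == i) || [exists k, collinear Q A i j k]]|%:R) ->
  (\dim (Q + spn v A))%:R <= (\dim Q)%:R + 144 * #|A|%:R / h.
Proof.
move=> h0 np hA; set W := (Q + spn v A)%VS.
have [le|lt] := leqP (\dim W) (\dim Q).
  apply: (@le_trans _ _ (\dim Q)%:R); first by rewrite ler_nat.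
  by rewrite lerDl divr_ge0 ?mulr_ge0 // ltW.
have [d [f [H [[d0 A10 QH kf] [n1d dens]]]]] := dense_quotient lt.
move: A10 n1d dens; set A1 := outside v A H => A10 n1d dens.
have A1A i : i \in A1 -> i \in A by rewrite inE => /andP[].
have [T uT hT] := radial_position d0 A10 dens.
pose w i := f (v i) *m T.
have vW i : i \in A -> v i \in W.
  by move=> iA; apply: (subvP (addvSr _ _)); apply: memv_spn.
have fH x : x \in H -> f x = 0.
  by rewrite -kf memv_cap => /andP[_]; rewrite memv_ker => /eqP.
have wH i : i \in A -> (w i == 0) = (v i \in H).
  move=> iA; apply/eqP/idP => [w0|/fH]; last by rewrite /w => ->; rewrite mul0mx.
  rewrite -kf memv_cap vW //= memv_ker; apply/eqP.
  by rewrite -(mulmxK uT (f (v i))) -/(w i) w0 mul0mx.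
have wlin i j k a b q : q \in Q -> v k = q + a *: v i + b *: v j ->
    w k = a *: w i + b *: w j.
  move=> qQ ek; rewrite /w ek !linearD !linearZ /= (fH q) ?(subvP QH) // add0r.
  by rewrite mulmxDl -!scalemxAl.
have {}hT j : j \in A1 ->
    d%:R * (\sum_(i in A1) cos2 (w i) (w j)) <= 4 * #|A1|%:R by exact: hT.
move: w wH wlin hT => w wH wlin hT.
pose g i j := cos2 (w i) (w j).
have g0 i j : 0 <= g i j by apply: cos2_ge0.
(* Triples inside [H] are discarded because [f] kills them. By [collinear_line] a remaining triple
   has at most one member in [H]. *)
pose col i j k := collinear Q A i j k && ~~ ((v i \in H) && (v j \in H)).
have col12 i j k : col i j k -> col j i k.
  by rewrite /col => /andP[/collinear12 ->]; rewrite andbC.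
have col23 i j k : col i j k -> col i k j.
  rewrite /col => /andP[ijk nij]; have ikj := collinear23 np ijk; rewrite ikj /=.
  apply: contra nij => /andP[iH kH]; rewrite iH.
  exact: (collinear_line np QH ikj iH kH).
have col_neq i j k : col i j k -> k != j by case/andP => /and3P[_ /and3P[]].
have col_trans i j k l : col i j k -> col i j l -> l != k -> col i k l.
  move=> ijk /andP[ijl _] lk; have /andP[_ nik] := col23 _ _ _ ijk.
  by rewrite /col nik andbT; case/andP: ijk => ijk _; exact: collinear_trans np ijk ijl lk.
have g_col i j k : col i j k -> 1 / 12 <= g i j + g i k + g j k.
  case/andP => ijk nij; have ikj := collinear23 np ijk.
  have /and3P[/and3P[iA jA kA] /and3P[ij ki kj]] := ijk.
  case/memv_addP => _ /memv_addP[q qQ [_ /vlineP[a ->] ->]] [_ /vlineP[b ->] ek].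
  have [np0 np1] := np.
  have a0 : a != 0.
    apply: contraNneq (np1 _ _ kA jA kj) => a0.
    by rewrite ek a0 scale0r addr0 memv_add // memvZ // memv_line.
  have b0 : b != 0.
    apply: contraNneq (np1 _ _ kA iA ki) => b0.
    by rewrite ek b0 scale0r addr0 memv_add // memvZ // memv_line.
  have ew := wlin _ _ _ _ _ _ qQ ek.
  (* If [w k = 0], then [w i] and [w j] are nonzero and proportional, so their [cos2] is 1. *)
  have [wk0|wk0] := eqVneq (w k) 0; last first.
    exact: cos2_coplanar a0 b0 ew wk0.
  have wi0 : w i != 0.
    apply: contra nij => wi0; have iH : v i \in H by rewrite -wH.
    rewrite iH; apply: (collinear_line np QH ikj iH).
    by rewrite -wH // wk0.
  have wij : w i = (- (b / a)) *: w j.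
    apply: (scalerI a0); rewrite scalerA mulrN mulrCA divff // mulr1 scaleNr.
    by apply/eqP; rewrite -subr_eq0 opprK -ew wk0.
  have wj0 : w j != 0 by apply: contraNneq wi0 => wj0; rewrite wij wj0 scaler0.
  have : g i j = 1.
    rewrite /g wij cos2Zl ?cos2_id //.
    by rewrite oppr_eq0 mulf_neq0 // invr_eq0.
  by move=> ->; have := g0 i k; have := g0 j k; lra.
have := triple_weight col12 col23 col_neq col_trans g_col.
have up : \sum_i \sum_(j | [exists k, col i j k]) g i j <=
    \sum_(i in A1) (\sum_(j in A1) g i j - 1).
  rewrite [leRHS]big_mkcond /=; apply: ler_sum => i _.
  have [iA1|niA1] := boolP (i \in A1); last first.
    rewrite big1 // => j /existsP[k /andP[/and3P[/and3P[iA _ _] /and3P[_ _ _] _] _]].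
    have : v i \in H by move: niA1; rewrite inE iA /= negbK.
    by rewrite -wH // => /eqP wi; rewrite /g /cos2 wi ip0l /nsqc /= expr0n addr0 mul0r.
  have gii : g i i = 1.
    by rewrite /g cos2_id // wH ?A1A //; move: iA1; rewrite inE => /andP[].
  rewrite [in leRHS](bigD1 i) //= gii.
  rewrite addrAC subrr add0r [leRHS]big_mkcond [leLHS]big_mkcond /=.
  apply: ler_sum => j _; case: ifP.
    case/existsP=> k /andP[/and3P[/and3P[iA jA _] /and3P[ij _ _] _] _].
    have [jA1|] := boolP (j \in A1); first by rewrite /= eq_sym ij.
    rewrite inE jA /= negbK -wH // => /eqP wj.
    by rewrite /g /cos2 ipC wj ip0l nsqc_conj /nsqc /= expr0n addr0 mul0r.
  by move=> _; case: ifP => // _; apply: cos2_ge0.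
have lo : #|A1|%:R * (h - 1) <= \sum_i #|[set j | [exists k, col i j k]]|%:R :> R.
  rewrite mulr_natl -sumr_const [leRHS](bigID (fun i => i \in A1)) /= -[leLHS]addr0 lerD //.
    rewrite big_mkcond [leRHS]big_mkcond; apply: ler_sum => i _ /=.
    case: ifP => // iA1; rewrite lerBlDr (le_trans (hA i (A1A _ iA1))) //.
    rewrite natr1 ler_nat; set S := [set j | [exists k, col i j k]].
    apply: (@leq_trans #|i |: S|); last by rewrite cardsU1; case: (i \notin S).
    apply: subset_leq_card; apply/subsetP => j; rewrite !inE => /andP[jA].
    case/orP => [->//|/existsP[k ijk]]; apply/orP; right; apply/existsP; exists k.
    by rewrite /col ijk; move: iA1; rewrite inE => /andP[_ /negbTE ->].
  by apply: sumr_ge0.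
have tot : d%:R * \sum_(i in A1) \sum_(j in A1) g i j <= #|A1|%:R * (4 * #|A1|%:R) :> R.
  rewrite mulr_sumr mulr_natl -sumr_const; apply: ler_sum => i iA1.
  by rewrite (eq_bigr (fun j => g j i)) => [|j _]; [exact: hT | exact: cos2C].
move: up lo tot; rewrite sumrB sumr_const.
move: (\sum_i \sum_(j | _) _) (\sum_i _%:R) (\sum_(i in A1) _) => X S G up lo tot trip.
have n1_gt0 : 0 < #|A1|%:R :> R by rewrite ltr0n.
(* 36 is [3 * 12], from [triple_weight] and [g_col]; the diagonal terms removed in [up] outweigh the
   [- 1] in [lo]. The 4 of [hT] then gives 144. *)
have GD : #|A1|%:R * (h / 36) <= G by lra.
have dh : d%:R * h <= 144 * #|A1|%:R.
  rewrite -(ler_pM2l n1_gt0); have d0' : 0 <= d%:R :> R by [].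
  by have := ler_wpM2l d0' GD; lra.
have eD : (\dim W)%:R = (\dim Q)%:R + (\dim W - \dim Q)%N%:R :> R.
  by rewrite -natrD subnKC // ltnW.
rewrite eD lerD2l ler_pdivlMr // -(ler_pM2l n1_gt0).
move: n1d; rewrite -(ler_nat R) !natrM -/W => n1d.
have := ler_wpM2r (ltW h0) n1d.
have n0 : 0 <= #|A|%:R :> R by [].
have := ler_wpM2l n0 dh.
move: #|A|%:R (#|A1|%:R) (\dim W - _)%N%:R => a b D; lra.
Qed.

End SylvesterGallai1.

(** * Configurations of higher level *)

Lemma card_le_rel (I : finType) (S W : {set I}) (r : rel I) :
  (forall u, u \in S -> exists2 w, w \in W & r u w) ->
  (forall u u' w, u \in S -> u' \in S -> w \in W -> r u w -> r u' w -> u = u') ->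
  (#|S| <= #|W|)%N.
Proof.
move=> ex inj; pose f u := odflt u [pick w in W | r u w].
have fP u : u \in S -> f u \in W /\ r u (f u).
  move=> uS; rewrite /f; case: pickP => [w /andP[]//|none].
  by have [w wW ruw] := ex u uS; have := none w; rewrite /= wW ruw.
have finj : {in S &, injective f}.
  move=> u u' uS u'S ff; have [fW ruf] := fP u uS; have [_] := fP u' u'S.
  by rewrite -ff; apply: inj.
rewrite -(card_in_imset finj); apply: subset_leq_card; apply/subsetP => _ /imsetP[u uS ->].
by have [] := fP u uS.
Qed.

Section Configurations.
Variables (R : realType) (E : vectType R[i]) (I : finType) (v : I -> E).
Implicit Types (Q U F : {vspace E}) (A B W : {set I}) (t s : seq I).

Notation spns s := (<<map v s>>)%VS.

Definition indep Q t := \dim (Q + spns t) = (\dim Q + size t)%N.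

Lemma spns_cons Q i t : (Q + spns (i :: t) = Q + <[v i]> + spns t)%VS.
Proof. by rewrite /= span_cons addvA. Qed.

Lemma indep_cons Q i t : v i \notin Q -> indep (Q + <[v i]>) t -> indep Q (i :: t).
Proof. by move=> iQ it; rewrite /indep spns_cons it dim_addv_line //= addSnnS. Qed.

Lemma indep_cap F t : indep F t -> (F :&: spns t = 0)%VS.
Proof.
rewrite /indep => it; apply/eqP; rewrite -dimv_eq0.
have := dimv_sum_cap F (spns t); have := dim_span (map v t); rewrite size_map it.
lia.
Qed.

Lemma indepW Q F t : (Q <= F)%VS -> indep F t -> indep Q t.
Proof.
move=> QF it; have c0 := indep_cap it.
have cQ : (Q :&: spns t = 0)%VS by apply/eqP; rewrite -subv0 -c0 capvS.
rewrite /indep dimv_disjoint_sum //; congr (_ + _)%N.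
have := it; rewrite /indep dimv_disjoint_sum //; lia.
Qed.

(** The two decompositions of [x] differ by a vector lying both in [F] and in the span of [t], hence
    zero. This brings relations modulo [F] down to [Q]. *)
Lemma indep_modular Q F P t x : (Q <= F)%VS -> indep F t -> (P <= spns t)%VS ->
  x \in (Q + spns t)%VS -> x \in (F + P)%VS -> x \in (Q + P)%VS.
Proof.
move=> QF /indep_cap c0 Pt /memv_addP[q qQ [y yt ->]] /memv_addP[z zF [p pP e]].
suff yp : y - p = 0 by rewrite memv_add // -(subrK p y) yp add0r.
apply/eqP; rewrite -memv0 -c0 memv_cap; apply/andP; split; last first.
  by rewrite rpredB // (subvP Pt).
have -> : y - p = z - q by apply/eqP; rewrite subr_eq addrAC -e addrAC subrr add0r.
by rewrite rpredB // (subvP QF).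
Qed.

(** [w] witnesses that the flat of [t] and [u] is not elementary: it is a point of that flat
    distinct, modulo [Q], from [u] and from those of [t]. *)
Definition extra Q A t u w := [&& w \in A, v w \in (Q + spns t + <[v u]>)%VS,
  v w \notin (Q + <[v u]>)%VS & all (fun i => v w \notin (Q + <[v i]>)%VS) t].

Definition good Q A W t :=
  [set u in A | (v u \in (Q + spns t)%VS) || [exists w, extra Q (A :|: W) t u w]].

(* Relative form of SG: everything is taken modulo [Q], points are lines
   through the origin, and the points of [W] may only serve as extra points. *)
Definition config Q k (a : R) A W :=
  nonparallel v Q A /\
  (forall t, size t = k -> {subset t <= A} -> indep Q t -> a <= #|good Q A W t|%:R).

Definition special Q A i :=
  [set j in A | (j == i) || [exists k, collinear v Q A i j k]].

Definition onthird Q A W i :=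
  [set u in A | (u == i) || [exists w, extra Q (A :|: W) [:: i] u w]].

(** A point outside [special Q A i] owes its third point to [W]. No two such points share it, for
    they would lie on one line through [i] and be special. *)
Lemma onthird_card Q A W i : nonparallel v Q A -> i \in A ->
  (#|onthird Q A W i| <= #|special Q A i| + #|W|)%N.
Proof.
move=> [np0 np1] iA; rewrite -(cardsID (special Q A i)) leq_add //.
  by rewrite subset_leq_card // subsetIr.
have exA u w : u \in A -> w \in A -> u != i -> extra Q (A :|: W) [:: i] u w ->
    u \in special Q A i.
  move=> uA wA ui; rewrite /extra /= span_seq1 andbT => /and4P[_ w1 w2 w3].
  rewrite inE uA (negbTE ui) /=; apply/existsP; exists w; rewrite /collinear iA uA wA w1 /=.
  rewrite (eq_sym i) ui andbT /=; apply/andP; split.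
    by apply: contraNneq w3 => ->; rewrite (subvP (addvSr _ _)) ?memv_line.
  by apply: contraNneq w2 => ->; rewrite (subvP (addvSr _ _)) ?memv_line.
apply: (@card_le_rel _ _ _ (fun u w => extra Q (A :|: W) [:: i] u w)).
  move=> u /setDP[]; rewrite inE => /andP[uA /orP[/eqP ->|/existsP[w ex]]].
    by rewrite inE iA eqxx.
  have [ui|ui] := eqVneq u i; first by rewrite ui inE iA eqxx.
  move=> ns; exists w => //; have /and4P[] := ex.
  by rewrite inE => /orP[wA|//]; case/negP: ns; apply: exA ex.
move=> u u' w /setDP[]; rewrite inE => /andP[uA _] ns.
case/setDP; rewrite inE => /andP[u'A _] ns' wW ex ex'.
apply/eqP; apply: contraT => uu'; case/negP: ns.
have [ui|ui] := eqVneq u i; first by rewrite ui inE iA eqxx.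
have ui' : u' != i by apply: contraNneq ns' => ->; rewrite inE iA eqxx.
move: ex ex'; rewrite /extra /= span_seq1 !andbT => /and4P[_ w1 w2 w3] /and4P[_ w1' w2' w3'].
rewrite inE uA (negbTE ui) /=; apply/existsP; exists u'; rewrite /collinear iA uA u'A /=.
rewrite (eq_sym i) ui ui' (eq_sym u') uu' /=.
apply: subvP (memv_exchange w1' w3'); rewrite subv_add addvSl /=.
by rewrite -memvE.
Qed.

Lemma good1_sub Q A W i : nonparallel v Q A -> i \in A ->
  good Q A W [:: i] \subset onthird Q A W i.
Proof.
move=> [_ np] iA; apply/subsetP => u; rewrite !inE /= span_seq1 => /andP[uA].
rewrite uA => /orP[ui|->]; last by rewrite orbT.
by have [->//|ne] := eqVneq u i; case/negP: (np _ _ uA iA ne).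
Qed.

(** The good points lost lie in the discarded set, of size at most [c]. No surviving point has a
    third point on its line through [i], so projecting from [i] neither merges survivors nor makes
    an extra point parallel to one it must avoid. *)
Lemma config_project Q k a A W i c : config Q k.+1 a A W -> i \in A ->
    #|onthird Q A W i|%:R <= c ->
  config (Q + <[v i]>) k (a - c) (A :\: onthird Q A W i) (W :|: onthird Q A W i).
Proof.
move=> [[np0 np1] cf] iA hc; set S := onthird Q A W i in hc *; set A' := A :\: S.
have A'A u : u \in A' -> u \in A by rewrite inE => /andP[].
have A'i u : u \in A' -> u != i.
  by rewrite !inE => /andP[]; case: eqVneq => // ->; rewrite iA.
have A'ex u w : u \in A' -> w \in A :|: W -> v w \in (Q + <[v i]> + <[v u]>)%VS ->
    v w \notin (Q + <[v i]>)%VS -> v w \in (Q + <[v u]>)%VS.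
  rewrite inE => /andP[uS uA] wAW w1 w2; apply: contraR uS => w3.
  rewrite inE uA; apply/orP; right; apply/existsP; exists w.
  by rewrite /extra wAW /= span_seq1 w1 w2 w3.
have A'Q u : u \in A' -> v u \notin (Q + <[v i]>)%VS.
  by move=> uA'; apply: np1 => //; [exact: A'A | exact: A'i].
split.
  split => [u /A'Q //|u u' uA' u'A' uu']; apply/negP => h.
  have := A'ex u' u u'A' _ h (A'Q _ uA'); rewrite inE A'A // => /(_ isT).
  by apply/negP; apply: np1; rewrite ?A'A.
move=> t st tA' it.
have iQ := np0 _ iA.
have := cf (i :: t); rewrite /= st => /(_ erefl) cf'.
have {}cf' : a <= #|good Q A W (i :: t)|%:R.
  apply: cf'; last exact: indep_cons.
  by move=> j; rewrite inE => /predU1P[->//|/tA' /A'A].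
suff sub : good Q A W (i :: t) \subset S :|: good (Q + <[v i]>) A' (W :|: S) t.
  have : (#|good Q A W (i :: t)| <= #|S| + #|good (Q + <[v i]>) A' (W :|: S) t|)%N.
    by apply: leq_trans (subset_leq_card sub) _; rewrite cardsU leq_subr.
  rewrite -(ler_nat R) natrD; lra.
apply/subsetP => u; rewrite inE spns_cons => /andP[uA gu].
rewrite inE; have [//|uS] := boolP (u \in S); rewrite /= inE.
have uA' : u \in A' by rewrite inE uS.
rewrite uA' /=; case/orP: gu => [->//|/existsP[w /and4P[wAW w1 w2 /= /andP[w3 /allP w4]]]].
apply/orP; right; apply/existsP; exists w; rewrite spns_cons in w1.
apply/and4P; split => //.
- case/setUP: wAW => [wA|wW]; last by rewrite !in_setU wW orbT.
  by rewrite in_setU in_setD in_setU wA; case: (w \in S); rewrite ?orbT.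
- by apply: contra w2 => h; apply: A'ex.
- apply/allP => j jt; apply: contra (w4 j jt) => h; apply: A'ex => //; exact: tA'.
Qed.

Lemma outside_spn Q A : outside v A (Q + spn v A)%VS = set0.
Proof.
apply/setP => i; rewrite !inE; apply/negP => /andP[iA].
by rewrite (subvP (addvSr _ _)) ?memv_spn.
Qed.

(** Each projection discards at most [c] points and adds them to [W], so [c] doubles while the
    dimension grows by 1. The losses [c + 2 * c + ...] sum to [(2 ^+ k - 1) * c]. *)
Lemma config_flat (h : R) k : 0 < h -> forall Q A W (a c : R),
  #|W|%:R + h <= c -> (2 ^+ k.+1 - 1) * c <= a -> config Q k.+1 a A W ->
  exists F, [/\ (Q <= F)%VS, #|outside v A F|%:R <= (2 ^+ k - 1) * c &
    (\dim F)%:R <= (\dim Q)%:R + k%:R + 144 * #|A|%:R / h].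
Proof.
move=> h0; elim: k => [|k IH] Q A W a c Wc ca cf;
  have [np cf1] := cf; have W0 : 0 <= #|W|%:R :> R by [];
  have c0 : 0 <= c by lra.
all: have [/forall_inP rich|] := boolP [forall i in A, h <= #|special Q A i|%:R].
- exists (Q + spn v A)%VS; rewrite outside_spn cards0 addvSl; split => //.
    by rewrite expr0 subrr mul0r.
  by rewrite addr0; apply: sg1_bound.
(* At level 1 a poor point is impossible: the good points for [[:: i]] would number less than
   [h + #|W| <= c <= a]. *)
- case/forallPn => i; rewrite negb_imply -ltNge => /andP[iA poor].
  have t_i : indep Q [:: i] by rewrite /indep span_seq1 dim_addv_line ?addn1 // np.1.
  have := cf1 [:: i] erefl; have tA : {subset [:: i] <= A}.
    by move=> j; rewrite inE => /eqP->.
  move=> /(_ tA t_i); have := subset_leq_card (good1_sub W np iA).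
  have := onthird_card W np iA; rewrite -!(ler_nat R) natrD expr1 in ca *; lra.
- exists (Q + spn v A)%VS; rewrite outside_spn cards0 addvSl; split => //.
    by rewrite mulr_ge0 // subr_ge0 exprn_ege1 // ler1n.
  by rewrite addrAC; apply: le_trans (sg1_bound h0 np rich) _; rewrite lerDl.
case/forallPn => i; rewrite negb_imply -ltNge => /andP[iA poor].
set S := onthird Q A W i.
have hS : #|S|%:R <= c.
  by have := onthird_card W np iA; rewrite -(ler_nat R) natrD -/S; lra.
have WS : #|W :|: S|%:R <= #|W|%:R + #|S|%:R :> R.
  by rewrite -natrD ler_nat cardsU leq_subr.
have [||F [QF oF dF]] := IH _ _ _ _ (2 * c) _ _ (config_project cf iA hS).
- by rewrite -/S; lra.
- by move: ca; rewrite !exprS; lra.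
exists F; split.
- by apply: subv_trans QF; apply: addvSl.
- have sub : outside v A F \subset S :|: outside v (A :\: S) F.
    apply/subsetP => j; rewrite in_setU inE => jAF.
    by have [//|jS] := boolP (j \in S); rewrite /= inE in_setD jS.
  have : (#|outside v A F| <= #|S| + #|outside v (A :\: S) F|)%N.
    by apply: leq_trans (subset_leq_card sub) _; rewrite cardsU leq_subr.
  by rewrite -(ler_nat R) natrD exprS; lra.
have d1 : (\dim (Q + <[v i]>))%:R = (\dim Q)%:R + 1 :> R.
  by rewrite dim_addv_line ?np.1 // -natr1.
have lA : 144 * #|A :\: S|%:R / h <= 144 * #|A|%:R / h.
  by rewrite ler_pM2r ?invr_gt0 // ler_pM2l // ler_nat subset_leq_card // subsetDl.
by rewrite d1 -/S in dF; rewrite -[k.+1%:R]natr1; lra.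
Qed.

(** * Points missed by a flat *)

Section Outside.
Variables (Q F : {vspace E}) (k : nat) (a : R) (A : {set I}).
Hypotheses (QF : (Q <= F)%VS) (cf : config Q k.+1 a A set0).
Let X := outside v A F.
Hypothesis X_small : 2 * #|X|%:R < a.

(* If every flat spanned by [s] and a point [u] of [F] had its extra point off
   the span of [s], that point would determine [u], and there would be too few
   such [u]. *)
Lemma outside_extra s : size s = k.+1 -> {subset s <= X} -> indep F s ->
  exists w, [/\ w \in X, v w \in (Q + spns s)%VS &
    forall i, i \in s -> v w \notin (Q + <[v i]>)%VS].
Proof.
move=> ss sX si; have [[np0 np1] cf1] := cf.
have XA j : j \in X -> j \in A by rewrite inE => /andP[].
have := cf1 s ss (fun j js => XA j (sX j js)) (indepW QF si).
set G := good _ _ _ _ => aG; apply: contrapT => none.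
suff : (#|G :\: X| <= #|X|)%N.
  have := cardsID X G; have := subset_leq_card (subsetIr G X) => cI cD cX.
  have : (#|G| <= 2 * #|X|)%N by rewrite -cD mul2n -addnn leq_add.
  rewrite -(ler_nat R) natrM => hG; have := lt_le_trans X_small (le_trans aG hG).
  by rewrite ltxx.
have GF u : u \in G :\: X -> u \in A /\ v u \in F.
  by rewrite !inE => /andP[nX /andP[uA _]]; move: nX; rewrite uA /= negbK.
(* Independence of [s] modulo [F] strips [s] from any relation inside [F]. *)
have modF P x : (P <= F)%VS -> (Q <= P)%VS -> x \in F -> x \in (P + spns s)%VS -> x \in P.
  move=> PF QP xF xP; have := indep_modular PF si (sub0v _) xP.
  by rewrite !addv0; apply.
have QuF u : v u \in F -> (Q + <[v u]> <= F)%VS by move=> uF; rewrite subv_add QF -memvE.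
pose r u w := [&& v w \in (Q + spns s + <[v u]>)%VS & v w \notin (Q + spns s)%VS].
apply: (@card_le_rel _ _ _ r) => [u uG|u u' w uG u'G wX].
  have [uA uF] := GF u uG; move: (uG); rewrite !inE => /andP[_ /andP[_ /orP[uQ|]]].
    by case/negP: (np0 _ uA); apply: modF uQ.
  case/existsP => w; rewrite /extra setU0 => /and4P[wA w1 w2 /allP w3].
  have wX : w \in X.
    rewrite inE wA; apply: contra w2 => wF.
    by apply: (modF _ _ (QuF u uF) (addvSl _ _) wF); rewrite -addvA (addvC <[v u]>%VS) addvA.
  exists w => //; rewrite /r w1; apply/negP => w4; apply: none.
  by exists w; split=> // i; apply: w3.
(* If [u] and [u'] share [w], exchange puts [v u] in the span of [Q], [s] and [v u']; inside [F]
   only [Q + <[v u']>] remains. *)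
case/andP => r1 r2 /andP[r1' _]; have [uA uF] := GF u uG; have [u'A u'F] := GF u' u'G.
apply/eqP; apply: contraT => uu'; case/negP: (np1 _ _ uA u'A uu').
apply: (modF _ _ (QuF u' u'F) (addvSl _ _) uF); rewrite -addvA (addvC <[v u']>%VS) addvA.
by apply: subvP (memv_exchange r1 r2); rewrite subv_add addvSl -memvE.
Qed.

End Outside.

(** [B] represents the missed points up to parallelism modulo [F]; the threshold [#|B|] asks every
    point of [B] to be good. For [u] and [t] in [B], [outside_extra] gives a missed point in the
    span of [u :: t], and its representative is the extra point. Adjoining [u] costs one level. *)
Lemma config_outside Q F k a A : (Q <= F)%VS -> config Q k.+2 a A set0 ->
    2 * #|outside v A F|%:R < a ->
  exists B, (spn v A <= F + spn v B)%VS /\ config F k.+1 #|B|%:R B set0.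
Proof.
move=> QF cf small; set X := outside v A F in small.
have [[np0 np1] _] := cf.
pose P B := (B \subset X) && `[< nonparallel v F B >].
have P0 : P set0.
  by rewrite /P sub0set; apply/asboolP; split => [i|i j]; rewrite inE.
have [B /andP[BX /asboolP[npB0 npB1]] maxB] : exists2 B, P B &
    forall B', P B' -> (#|B'| <= #|B|)%N.
  by case: (arg_maxnP (fun B : {set I} => #|B|) P0) => B; exists B.
have rep w : w \in X -> exists2 b, b \in B & v w \in (F + <[v b]>)%VS.
  move=> wX; have [wB|wB] := boolP (w \in B).
    by exists w; rewrite // (subvP (addvSr _ _)) ?memv_line.
  apply: contrapT => none.
  have wF : v w \notin F by move: wX; rewrite inE => /andP[].
  have nwb b : b \in B -> v w \notin (F + <[v b]>)%VS.
    by move=> bB; apply/negP => h; apply: none; exists b.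
  suff /maxB : P (w |: B) by rewrite cardsU1 wB add1n ltnn.
  rewrite /P subUset sub1set wX BX; apply/asboolP; split => [i|i j].
    by rewrite !inE => /predU1P[->|/npB0].
  rewrite !inE => /predU1P[->|iB] /predU1P[->|jB].
  - by rewrite eqxx.
  - by move=> _; apply: nwb.
  - move=> _; apply: contra (nwb i iB) => h.
    exact: memv_exchange h (npB0 _ iB).
  - exact: npB1.
exists B; split.
  apply: spn_subv => i iA; have [iF|iF] := boolP (v i \in F).
    by rewrite (subvP (addvSl _ _)).
  have [|b bB ib] := rep i; first by rewrite inE iA.
  by apply: subvP ib; rewrite addvS // -memvE memv_spn.
split => // t st tB it; rewrite ler_nat; apply: subset_leq_card.
apply/subsetP => u uB; rewrite inE uB setU0.
have [//|ut] := boolP (v u \in _) => /=; apply/existsP.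
have it' : indep F (u :: t).
  rewrite /indep /= span_cons (addvC <[v u]>%VS) addvA dim_addv_line // it.
  by rewrite addnS.
have ss : size (u :: t) = k.+2 by rewrite /= st.
have sB : {subset u :: t <= B} by move=> j; rewrite inE => /predU1P[->|/tB].
have sX j : j \in u :: t -> j \in X by move/sB; apply: (subsetP BX).
have [w [wX w1 w2]] := outside_extra QF cf small ss sX it'.
have [b bB wb] := rep w wX; exists b.
have wF : v w \notin F by move: wX; rewrite inE => /andP[].
have bw := memv_exchange wb wF.
(* If [b] were parallel to [j] modulo [F], so would be [w]; [indep_modular] brings this down to [Q],
   against [w2]. *)
have nb j : j \in u :: t -> v b \notin (F + <[v j]>)%VS.
  move=> js; apply: contra (w2 j js) => bj.
  have jt : (<[v j]> <= spns (u :: t))%VS by rewrite -memvE memv_span ?map_f.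
  apply: (indep_modular QF it' jt w1).
  apply: subvP wb; rewrite subv_add addvSl /=.
  by rewrite -memvE.
apply/and4P; split => //.
- apply: subvP bw; rewrite subv_add -addvA addvSl /= -memvE.
  apply: subvP w1; rewrite /= span_cons (addvC <[v u]>%VS) addvS //.
- by apply: nb; rewrite inE eqxx.
- by apply/allP => j jt; apply: nb; rewrite inE jt orbT.
Qed.

(** The points missed by the flat of [config_flat] are handled by induction with density 1, so the
    ratio [#|A| / a] enters only once, and linearly. *)
Lemma config_dim k Q A (a : R) : 0 < a -> a <= #|A|%:R ->
  config Q k.+1 a A set0 ->
  (\dim (Q + spn v A))%:R <= (\dim Q)%:R + 2 ^+ (k + 11) * (#|A|%:R / a).
Proof.
elim: k Q A a => [|k IH] Q A a a0 aA cf;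
  set L := #|A|%:R / a; have L1 : 1 <= L by rewrite ler_pdivlMr // mul1r.
- have h0 : 0 < a / 4 by rewrite divr_gt0.
  have [||F [QF oF dF]] := config_flat h0 (c := a / 4) _ _ cf.
  + by rewrite cards0; lra.
  + by rewrite expr1; lra.
  have X0 : #|outside v A F|%:R = 0 :> R.
    by apply/eqP; rewrite eq_le ler0n andbT; rewrite expr0 subrr mul0r in oF.
  have WF : (Q + spn v A <= F)%VS.
    rewrite subv_add QF; apply: spn_subv => i iA; apply: contraT => nF.
    by move/eqP: X0; rewrite pnatr_eq0 cards_eq0 => /eqP/setP/(_ i); rewrite !inE iA nF.
  have : (\dim (Q + spn v A))%:R <= (\dim F)%:R :> R by rewrite ler_nat dimvS.
  have eL : 144 * #|A|%:R / (a / 4) = 576 * L by rewrite /L; field; lra.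
  by rewrite eL in dF; rewrite add0n; move: dF; nra.
pose p : R := 2 ^+ k; have p1 : 1 <= p by rewrite exprn_ege1 // ler1n.
have kp : (k.+1)%:R <= p * 2 :> R.
  by rewrite /p -exprSr -natrX ler_nat ltnW // ltn_expl.
(* With [c = a / (8 * p)], the flat misses at most [(2 * p - 1) * c < a / 4] points, below the
   [a / 2] that [config_outside] allows. *)
have h0 : 0 < a / (8 * p) by rewrite divr_gt0 // mulr_gt0 //; lra.
have pa : 8 * p * (a / (8 * p)) = a by field; lra.
have [||F [QF oF dF]] := config_flat h0 (c := a / (8 * p)) _ _ cf.
- by rewrite cards0; lra.
- by rewrite !exprS -/p; lra.
have small : 2 * #|outside v A F|%:R < a by rewrite exprS -/p in oF; lra.
have [B [AB cB]] := config_outside QF cf small.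
have eL : 144 * #|A|%:R / (a / (8 * p)) = 1152 * p * L by rewrite /L; field; lra.
rewrite eL in dF.
have dB : (\dim (F + spn v B))%:R <= (\dim F)%:R + 2048 * p :> R.
  have [->|[b bB]] := set_0Vmem B.
    by rewrite /spn big_set0 addv0 lerDl; lra.
  have B0 : 0 < #|B|%:R :> R by rewrite ltr0n; apply/card_gt0P; exists b.
  have := IH F B _ B0 (lexx _) cB; rewrite divff ?gt_eqF // mulr1 exprD -/p.
  by rewrite (_ : 2 ^+ 11 = 2048) ?(mulrC p) //; ring.
have : (\dim (Q + spn v A))%:R <= (\dim (F + spn v B))%:R :> R.
  by rewrite ler_nat dimvS // subv_add AB (subv_trans QF) ?addvSl.
(* As [L >= 1], the total is at most [(2 + 1152 + 2048) * p * L], within [4096 * p * L]. *)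
rewrite addSn exprS exprD -/p (_ : 2 ^+ 11 = 2048); last by ring.
by nra.
Qed.

End Configurations.

(** * Homogenization of affine configurations *)

Section Homogenization.
Variables (K : fieldType) (d : nat).
Implicit Types (x y : 'rV[K]_d) (s : seq 'rV[K]_d) (P : {vspace 'rV[K]_(1 + d)}).

Definition homog x : 'rV[K]_(1 + d) := row_mx 1%:M x.

Definition dir x : 'rV[K]_(1 + d) := row_mx 0 x.

Fact dir_is_linear : linear dir.
Proof. by move=> a x y; rewrite /dir scale_row_mx add_row_mx scaler0 addr0. Qed.

HB.instance Definition _ := GRing.isLinear.Build _ _ _ _ dir dir_is_linear.

Lemma homogB x y : homog x - homog y = dir (x - y).
Proof. by rewrite /homog /dir opp_row_mx add_row_mx subrr. Qed.

Lemma homog_sum (n : nat) (c : 'I_n -> K) (f : 'I_n -> 'rV[K]_d) :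
  \sum_i c i *: homog (f i) = row_mx ((\sum_i c i)%:M) (\sum_i c i *: f i).
Proof.
elim/big_rec3: _ => [|i y2 y1 y3 _ ->]; first by rewrite raddf0 row_mx0.
by rewrite /homog scale_row_mx add_row_mx scale_scalar_mx mulr1 raddfD.
Qed.

(** The first coordinate of a combination of homogenized points is the sum of its coefficients,
    which is thus forced to be 1. *)
Lemma fl_homog s x : fl s x <-> homog x \in <<map homog s>>%VS.
Proof.
split=> [[c [c1 ->]]|].
  have -> : homog (\sum_(i < size s) c i *: s`_i) = \sum_(i < size s) c i *: homog s`_i.
    by rewrite homog_sum c1.
  by apply: memv_suml => i _; rewrite memvZ // memv_span // map_f // mem_nth.
move=> h; have := coord_span (X := map_tuple homog (in_tuple s)) h.
have -> : \sum_(i < size s) coord (map_tuple homog (in_tuple s)) i (homog x) *: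
    (map_tuple homog (in_tuple s))`_i =
    \sum_(i < size s) coord (map_tuple homog (in_tuple s)) i (homog x) *: homog s`_i.
  by apply: eq_bigr => i _; rewrite (nth_map 0).
rewrite homog_sum => /eq_row_mx[c1 ex].
exists (fun i => coord (map_tuple homog (in_tuple s)) i (homog x)); split => //.
by have /matrixP/(_ 0 0) := c1; rewrite !mxE eqxx !mulr1n.
Qed.

Lemma homog_notin_dir x : homog x \notin limg (linfun dir).
Proof.
apply/negP => /memv_imgP[y _]; rewrite lfunE => /eq_row_mx[/matrixP/(_ 0 0)].
by rewrite !mxE eqxx => /eqP; rewrite oner_eq0.
Qed.

(** [P] splits into its part at infinity, which is the direction space, and the line of [homog x0];
    hence the shift by 1. *)
Lemma flat_homog P x0 : homog x0 \in P ->
  flat (Posz (\dim P) - 1) (fun x => homog x \in P).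
Proof.
move=> x0P; right; pose U := (linfun dir @^-1: P)%VS; exists x0, U.
have kd : lker (linfun dir) == 0%VS.
  by apply/lker0P => x y; rewrite !lfunE => /eq_row_mx[].
have dU : \dim U = \dim (P :&: limg (linfun dir)).
  have := lpreimK (capvSr P (limg (linfun dir))); rewrite lpreim_cap_limg -/U => <-.
  by rewrite limg_dim_eq // (eqP kd) capv0.
have eP : P = (P :&: limg (linfun dir) + <[homog x0]>)%VS.
  apply/eqP; rewrite eqEsubv subv_add capvSl -memvE x0P !andbT.
  apply/subvP => p pP; pose c := lsubmx p 0 0.
  rewrite -(subrK (c *: homog x0) p) memv_add ?memvZ ?memv_line //.
  rewrite memv_cap rpredB ?rpredZ //=; apply/memv_imgP; exists (rsubmx p - c *: x0).
    exact: memvf.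
  rewrite lfunE /= /dir -{1}(hsubmxK p) /homog scale_row_mx opp_row_mx add_row_mx.
  congr row_mx; apply/matrixP => i j; rewrite !ord1 !mxE eqxx mulr1 /c.
  by rewrite !mxE subrr.
split.
  rewrite eP dim_addv_line -?dU; first by lia.
  by rewrite memv_cap negb_and homog_notin_dir orbT.
apply/funext => x; apply/propext; rewrite /= -memv_preim lfunE /= -homogB.
by split => h; [rewrite rpredB | rewrite -(subrK (homog x0) (homog x)) rpredD].
Qed.

Lemma independent_homog s : s != [::] -> \dim <<map homog s>> = size s -> independent s.
Proof.
case: s => // x s _ ds; rewrite /independent -ds.
rewrite (_ : fl _ = fun y => homog y \in <<map homog (x :: s)>>%VS).
  by apply: (@flat_homog _ x); rewrite memv_span // mem_head.
by apply/funext => y; apply/propext; apply: fl_homog.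
Qed.

End Homogenization.

(** * From affine SG configurations to linear ones *)

Section FromSG.
Variables (R : realType) (d : nat) (V : {fset 'rV[R[i]]_d}).

Let v (i : V) := homog (val i).

Lemma nonparallel_homog : nonparallel v 0%VS setT.
Proof.
have n0 (i : V) : v i \notin 0%VS.
  by rewrite memv0 -(linear0 (@dir R[i] d)); apply/eqP => /eq_row_mx[/matrixP/(_ 0 0)];
     rewrite !mxE eqxx => /eqP; rewrite oner_eq0.
split=> [i _ //|i j _ _ ij]; rewrite add0v; apply: contra ij => /vlineP[c].
rewrite /v /homog scale_row_mx => /eq_row_mx[/matrixP/(_ 0 0)].
by rewrite !mxE eqxx mulr1n mulr1 => <-; rewrite scale1r => /val_inj ->.
Qed.

Lemma spn_homog : spn v setT = <<map (@homog R[i] d) V>>%VS.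
Proof.
apply/eqP; rewrite eqEsubv; apply/andP; split.
  by apply: spn_subv => i _; rewrite memv_span // /v map_f //; apply: valP.
apply/span_subvP => _ /mapP[x xV ->].
by have := @memv_spn _ _ _ v setT [` xV]%fset (in_setT _).
Qed.

(** For minimality, an affine space [p + U] containing [V] lifts to the span of [homog p] and the
    directions [U], which contains [spn v setT]. *)
Lemma affine_dim_homog : V != fset0 :> {fset _} ->
  affine_dim V (Posz (\dim (spn v setT)) - 1).
Proof.
case/fset0Pn => x0 x0V.
have vP x : x \in V -> homog x \in spn v setT.
  by move=> xV; rewrite spn_homog memv_span // map_f.
exists (fun x => homog x \in spn v setT); split => //.
  by apply: (@flat_homog _ _ _ x0); apply: vP.
move=> m' G [[_ ->] /(_ _ x0V)//|[p [U [_ ->]]] VG x /=].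
pose P' := (<[homog p]> + linfun (@dir R[i] d) @: U)%VS.
suff /subvP PP' : (spn v setT <= P')%VS.
  move/PP' => /memv_addP[_ /vlineP[c ->] [_ /memv_imgP[y yU ->]]].
  rewrite lfunE /= /homog /dir scale_row_mx add_row_mx addr0.
  case/eq_row_mx => /matrixP/(_ 0 0); rewrite !mxE eqxx mulr1n mulr1 => <- ->.
  by rewrite scale1r addrC addKr.
apply: spn_subv => i _; have ip : val i - p \in U by exact: VG (valP i).
rewrite -(subrK (homog p) (v i)) addrC memv_add ?memv_line // homogB.
by rewrite -[dir _](lfunE (@dir R[i] d)) memv_img.
Qed.

(** By contraposition: without an extra point, the flat of [t] and a point [u] off the span of [t]
    meets [V] only in the [k.+2] points generating it, hence is elementary. *)
Lemma config_homog k (delta : R) : SG delta k.+1 V ->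
  config v 0%VS k.+1 (delta * #|` V|%:R) setT set0.
Proof.
move=> sg; split=> [|t st _ it]; first exact: nonparallel_homog.
have [np0 np1] := nonparallel_homog.
pose s := map val t.
have es : map v t = map (@homog R[i] d) s by rewrite /s -map_comp.
have ds : \dim <<map (@homog R[i] d) s>> = k.+1.
  by move: it; rewrite /indep add0v dimv0 st es.
have ss : size s == k.+1 by rewrite size_map st.
have sV : {subset s <= V} by move=> _ /mapP[i _ ->]; apply: valP.
have {sg} := sg (Tuple ss) sV; rewrite /= => sg.
have /sg {sg} : independent s.
  by apply: independent_homog; rewrite -?size_eq0 (eqP ss).
move/le_trans; apply; rewrite ler_nat.
set S := [fset _ in V | _]%fset.
have /fsubset_leq_card : (S `<=` [fset val u | u in good v 0%VS setT set0 t])%fset.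
  apply/fsubsetP => u; rewrite !in_fsetE /= inE => /andP[uV /asboolP gu].
  apply/imfsetP; exists [` uV]%fset => //=; rewrite !inE /=.
  have [//|ut] := boolP (_ \in _); apply/existsP.
  rewrite add0v es in ut; case: gu => [/fl_homog|ne]; first by rewrite (negbTE ut).
  apply: contrapT => none; apply: ne; set r := rcons s u.
  have rV : {subset r <= V}.
    by move=> x; rewrite mem_rcons inE => /predU1P[->|/sV].
  have er : (<<map (@homog R[i] d) r>> = <<map (@homog R[i] d) s>> + <[homog u]>)%VS.
    by rewrite map_rcons -cats1 span_cat span_seq1.
  have dr : \dim <<map (@homog R[i] d) r>> = k.+2 by rewrite er dim_addv_line // ds.
  have sr : size r = k.+2 by rewrite size_rcons (eqP ss).
  have ur : uniq r.
    by apply: (@map_uniq _ _ (@homog R[i] d)); apply: free_uniq; rewrite /free size_map dr sr.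
  split.
    have := @independent_homog _ _ r; rewrite /independent dr sr => /(_ _ erefl).
    rewrite (_ : Posz k.+2 - 1 = k.+1); last by rewrite -[k.+2]addn1 PoszD addrK.
    by apply; rewrite -size_eq0 sr.
  have cr : #|` [fset x in r]%fset| = k.+2 by rewrite card_fseq undup_id.
  rewrite -[RHS]cr; congr (#|` _|%N).
  apply/fsetP => x; rewrite !in_fsetE /= inE; apply/andP/idP => [[xV /asboolP/fl_homog xr]|xr].
    apply: contraT => nxr; case: none; exists [` xV]%fset.
    rewrite /extra !inE /= add0v es -er xr /=; apply/andP; split.
      have /np1 : [` xV]%fset \in setT by rewrite inE.
      move=> /(_ [` uV]%fset); rewrite inE => /(_ isT); apply.
      by apply: contraNneq nxr => /(congr1 val) /= ->; rewrite mem_rcons mem_head.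
    apply/allP => i it'; apply: np1; rewrite ?inE //.
    apply: contraNneq nxr => /(congr1 val) /= ->.
    by rewrite mem_rcons inE map_f ?orbT.
  by split; [apply: rV | apply/asboolP/fl_homog; rewrite memv_span // map_f].
move/leq_trans; apply; apply: leq_trans (leq_imfset_card _ _ _) _.
by rewrite cardE.
Qed.

End FromSG.

Theorem theorem5p4 (R : realType) :
  exists C : R, 1 < C /\
    forall (k : nat) (delta : R) (d : nat) (V : {fset 'rV[R[i]]_d}),
      (1 <= k)%N -> 0 < delta -> delta <= 1 -> SG delta k V ->
      exists m : int,
        affine_dim V m /\ m%:~R <= 2 `^ (C ^+ k) / delta ^+ 2.
Proof.
(* 11 matches the exponent of [config_dim]: [k + 11 <= 11 ^ k.+1], with equality at [k = 0], where
   the level is [k.+1]. *)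
exists 11%:R; split; first by rewrite ltr1n.
move=> [//|k] delta d V _ d0 d1 sg.
have rhs0 : 0 <= 2 `^ (11%:R ^+ k.+1) / delta ^+ 2.
  by rewrite divr_ge0 ?powR_ge0 ?sqr_ge0.
have [->|V0] := eqVneq V fset0%fset.
  exists (-1); split; last by rewrite mulrN1z (le_trans _ rhs0) // lerN10.
  exists classical_sets.set0; split => //; first by left.
  by move=> m' G _ _ x.
have n0 : 0 < #|` V|%:R :> R by rewrite ltr0n cardfs_gt0.
have eV : #|[set: V]| = #|` V| by rewrite cardsT cardfE.
eexists; split; first exact: affine_dim_homog V0.
have an : delta * #|` V|%:R <= #|[set: V]|%:R by rewrite eV ler_piMl // ltW.
have := config_dim (mulr_gt0 d0 n0) an (config_homog sg).
rewrite add0v dimv0 add0r eV => dim_le.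
apply: (@le_trans _ _ (2 ^+ (k + 11) / delta)).
  have -> : 2 ^+ (k + 11) / delta = 2 ^+ (k + 11) * (#|` V|%:R / (delta * #|` V|%:R)).
    by field; rewrite !gt_eqF.
  by apply: le_trans dim_le; rewrite intrD lerBlDr lerDl.
have -> : 11%:R ^+ k.+1 = (11 ^ k.+1)%N%:R :> R by rewrite natrX.
rewrite powR_mulrn ?ler0n // ler_pM ?exprn_ge0 ?invr_ge0 ?(ltW d0) //.
  rewrite ler_eXn2l ?ltr1n //.
  elim: k {sg dim_le rhs0} => // k IH; rewrite expnS; lia.
(* The bound obtained is linear in [1 / delta]; [delta <= 1] yields the square. *)
by rewrite lef_pV2 ?posrE ?exprn_gt0 // expr2 ler_piMl // ltW.
Qed.
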